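(* Let $J\ge2$, let $\tilde w_1,\dots,\tilde w_J$ be fixed measurable symmetric functions $[0,1]^2\to[0,1]$, and for $\rho\in(0,1]$ put $w_j=\rho\tilde w_j$ and $w^\star=1-\prod_{j=1}^J(1-w_j)$. Assume that $1,w_1,\dots,w_J$ are linearly independent in $L_2([0,1]^2)$. With the sets $\mathcal C,\mathcal C_c,\mathcal K,\mathcal K_0,\mathcal H,\mathcal H_0,\tilde{\mathcal H}_0$ and the function $e_2$ defined in the context, the following hold as $\rho\to0$. (i) $\operatorname{dist}^2(w^\star,\mathcal C_c)\asymp\rho^2$ and $\operatorname{dist}^2(w^\star,\mathcal C)\asymp\rho^2$. (ii) There is $\rho_0>0$, depending only on the templates $\tilde w_1,\dots,\tilde w_J$, such that for $0<\rho\le\rho_0$ the coefficients on the agents $w_1,\dots,w_J$ of the orthogonal projection of $w^\star$ onto $\mathcal H$, and of its orthogonal projection onto $\mathcal H_0$, are $1+O(\rho)>0$; consequently $$\operatorname{dist}(w^\star,\mathcal K)=\operatorname{dist}(w^\star,\mathcal H)\quad\text{and}\quad \operatorname{dist}(w^\star,\mathcal K_0)=\operatorname{dist}(w^\star,\mathcal H_0),$$ with $$\operatorname{dist}^2(w^\star,\mathcal H)=\rho^4\operatorname{dist}^2(e_2,\mathcal H)\{1+O(\rho)\}\quad\text{when } e_2\notin\mathcal H,$$ $$\operatorname{dist}^2(w^\star,\mathcal H_0)=\rho^4\operatorname{dist}^2(e_2,\tilde{\mathcal H}_0)\{1+O(\rho)\}\quad\text{when } e_2\notin\tilde{\mathcal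 H}_0.$$ Thus nonnegativity of the weights costs nothing at any order, the intercept changes only the fourth-order constant, and the sum-to-one constraint alone produces the second-order floor.
   Context: $\|\cdot\|$ is the $L_2([0,1]^2)$ norm and $\operatorname{dist}(w,\mathcal S)=\inf_{h\in\mathcal S}\|w-h\|$. $\Delta_J$ is the probability simplex in $\mathbb R^J$. Define - the simplex (hull) $\mathcal C=\{\sum_j\pi_jw_j:\pi\in\Delta_J\}$; - the intercept simplex $\mathcal C_c=\{c+\sum_j\pi_jw_j:c\in\mathbb R,\ \pi\in\Delta_J\}$; - the nonnegative cone with free intercept $\mathcal K=\{c+\sum_j\gamma_jw_j:c\in\mathbb R,\ \gamma_j\ge0\}$; - the cone without intercept $\mathcal K_0=\{\sum_j\gamma_jw_j:\gamma_j\ge0\}$; - the span $\mathcal H=\{\beta_0+\sum_j\beta_jw_j:\beta\in\mathbb R^{J+1}\}$; - the span without intercept $\mathcal H_0=\mathrm{span}(w_1,\dots,w_J)$, and $\tilde{\mathcal H}_0=\mathrm{span}(\tilde w_1,\dots,\tilde w_J)$. The pairwise interaction is $e_2=\sum_{j<k}\tilde w_j\tilde w_k$. $x\asymp y$ means that $x/y$ is bounded above and below by positive constants for all small $\rho$; all implied constants depend only on the templates $\tilde w_j$. *)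

(* Defs.v *)
From mathcomp Require Import all_boot all_order all_algebra.
From mathcomp Require Import all_classical all_reals all_analysis.

Set Implicit Arguments.
Unset Strict Implicit.
Unset Printing Implicit Defensive.

Import Order.TTheory GRing.Theory Num.Theory.
Import numFieldNormedType.Exports.

Local Open Scope classical_set_scope.
Local Open Scope ring_scope.

(* The library's Lebesgue measure lives on measurableTypeR R, which is R with its
   Borel sigma-algebra; the plane carries the product sigma-algebra. *)
Notation plane R := (measurableTypeR R * measurableTypeR R)%type.

Notation lebesgue2 := (lebesgue_measure \x lebesgue_measure)%E.

(* Elements of L_2([0,1]^2) are represented by functions on the plane, of which
   only the restriction to the unit square matters; equality in L_2 is equality
   almost everywhere on the unit square. *)
Section UnitSquare.
Context {R : realType}.
Implicit Types (f g h : plane R -> R) (S : set (plane R -> R)).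

Definition unit_square : set (plane R) := `[0, 1]%classic `*` `[0, 1]%classic.

(* [fine] maps +oo to 0, so this is the L_2 norm only for functions that are
   square-integrable on the unit square, e.g. bounded and measurable there. *)
Definition L2norm f : R :=
  fine ('N[lebesgue2]_2%:E [EFin \o (f \_ unit_square)])%E.

Definition L2inner f g : R :=
  (\int[lebesgue2]_(z in unit_square) (f z * g z))%R.

Definition L2eq f g : Prop := ae_eq lebesgue2 unit_square f g.

Definition L2mem f S : Prop := exists2 h, S h & L2eq f h.

Definition L2dist f S : R := inf [set L2norm (f \- h) | h in S].

Definition is_orth_proj f S h : Prop :=
  S h /\ forall g, S g -> L2inner (f \- h) g = 0.

End UnitSquare.

Section Combinations.
Context {R : realType} {J : nat}.
Implicit Types (w : 'I_J -> plane R -> R) (g : 'I_J -> R) (c : R).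

Definition lincomb g w : plane R -> R := fun z => \sum_(j < J) g j * w j z.

Definition affcomb c g w : plane R -> R :=
  fun z => c + \sum_(j < J) g j * w j z.

Definition free_with_one w : Prop :=
  forall c g, L2eq (affcomb c g w) (cst 0) -> c = 0 /\ forall j, g j = 0.

Definition prob_simplex : set ('I_J -> R) :=
  [set p | (forall j, 0 <= p j) /\ \sum_(j < J) p j = 1].

Definition nonneg_orthant : set ('I_J -> R) :=
  [set g | forall j, 0 <= g j].

Definition weight_hull w : set (plane R -> R) :=
  [set lincomb p w | p in prob_simplex].

Definition intercept_hull w : set (plane R -> R) :=
  [set affcomb c p w | c in [set: R] & p in prob_simplex].

Definition intercept_cone w : set (plane R -> R) :=
  [set affcomb c g w | c in [set: R] & g in nonneg_orthant].

Definition weight_cone w : set (plane R -> R) :=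
  [set lincomb g w | g in nonneg_orthant].

Definition intercept_span w : set (plane R -> R) :=
  [set affcomb c g w | c in [set: R] & g in [set: 'I_J -> R]].

Definition linspan w : set (plane R -> R) :=
  [set lincomb g w | g in [set: 'I_J -> R]].

Definition scaled (rho : R) w : 'I_J -> plane R -> R :=
  fun j z => rho * w j z.

Definition noisy_or w : plane R -> R := fun z => 1 - \prod_(j < J) (1 - w j z).

Definition pair_interaction w : plane R -> R :=
  fun z => \sum_(j < J) \sum_(k < J | (j < k)%N) w j z * w k z.

End Combinations.

Definition asymp {R : realType} (x y : R -> R) : Prop :=
  exists c C : R, [/\ 0 < c, 0 < C &
    \forall r \near 0^'+, c <= x r / y r <= C].

(* Main.v *)
Require Import Defs.
From mathcomp Require Import all_boot all_order all_algebra.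
From mathcomp Require Import all_classical all_reals all_analysis.
From mathcomp Require Import ring lra.

Set Implicit Arguments.
Unset Strict Implicit.
Unset Printing Implicit Defensive.

Import Order.TTheory GRing.Theory Num.Theory.
Import numFieldNormedType.Exports.
Import measurable_realfun.

Local Open Scope classical_set_scope.
Local Open Scope ring_scope.

(** Write [s] for the sum of the templates and [e] for their pair interaction.
    Expanding the product gives, uniformly on the unit square,
    [noisy_or (scaled r wt) = r * s - r ^+ 2 * e + O(r ^+ 3)]
    ([noisy_or_third_order], [noisy_or_expansion]), and every claim compares
    this expansion with a linear span.

    The first-order term [r * s] lies in both spans, with all weights equal to
    [1]. Distance to a span ignores it, scales with the second-order term and
    is 1-Lipschitz, so the distance of the noisy-or is [r ^+ 2] times that of
    [e], up to [O(r ^+ 3)] ([L2dist_second_order]); squaring turns this into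
    the relative error [1 + O(r)] ([sqr_relative_error]) as soon as [e] is at a
    positive distance, which holds outside the span since the distance is
    attained ([L2dist_linspan_gt0]).

    Linear independence makes the Gram matrix invertible. This yields
    orthogonal projections and a constant [C] bounding each coefficient of a
    combination by [C] times its norm ([coef_le_L2norm]). The projection of the
    noisy-or is at distance [O(r ^+ 2)] from [r * s], since projecting
    contracts distances, so its weights in terms of the scaled agents differ
    from [1] by [O(r)] ([orth_proj_coef_le]). They are therefore positive for
    small [r]: the projection lies in the cone, and the cone and the span are
    equally far.

    For the hulls, [r * s] minus an admissible combination has coefficients
    [r * (1 - p j)], which sum to [r * (J - 1)] and [J - 1 >= 1]. The
    coefficient bound keeps [r * s] at distance at least of order [r] from the
    hull, and the remaining [O(r ^+ 2)] cannot close the gap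
    ([dist_hull_asymp]).

    The intercept is treated as one more template, the constant function [1]
    ([with_one]), so that each statement about spans is proved once. *)

(** * Bounded measurable functions on the unit square *)

Section SquareIntegration.
Context {R : realType}.
Implicit Types (f g h : plane R -> R) (S : set (plane R -> R)) (a b M : R).

(** Boundedness makes this class closed under products, as the noisy-or and
    the pair interaction require, while integrability over the square is
    automatic. *)
Definition bounded_meas f : Prop :=
  measurable_fun unit_square f /\
  exists M, forall z, unit_square z -> `|f z| <= M.

Lemma measurable_unit_square : measurable (@unit_square R).
Proof. by apply: measurableX; exact: measurable_itv. Qed.

Lemma lebesgue2_unit_square : lebesgue2 (@unit_square R) = 1%E.
Proof.
have e : @lebesgue_measure R `[0, 1]%classic = 1%E.
  by rewrite lebesgue_measure_itv /= lte01 oppr0 adde0.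
rewrite /unit_square product_measure1E; try exact: measurable_itv.
rewrite -[RHS]mule1; congr (_ * _)%E; exact: e.
Qed.

Lemma bounded_meas_cst a : bounded_meas (cst a).
Proof. by split; [exact: measurable_cst|exists `|a|]. Qed.

Lemma bounded_measD f g :
  bounded_meas f -> bounded_meas g -> bounded_meas (fun z => f z + g z).
Proof.
move=> [mf [M fM]] [mg [N gN]]; split; first exact: measurable_funD.
exists (M + N) => z Dz; apply: le_trans (ler_normD _ _) _.
by apply: lerD; [exact: fM|exact: gN].
Qed.

Lemma bounded_measM f g :
  bounded_meas f -> bounded_meas g -> bounded_meas (fun z => f z * g z).
Proof.
move=> [mf [M fM]] [mg [N gN]]; split; first exact: measurable_funM.
exists (M * N) => z Dz; rewrite normrM.
by apply: ler_pM => //; [exact: fM|exact: gN].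
Qed.

Lemma bounded_measZ a f : bounded_meas f -> bounded_meas (fun z => a * f z).
Proof. by move=> ?; apply: bounded_measM => //; exact: bounded_meas_cst. Qed.

Lemma bounded_measB f g :
  bounded_meas f -> bounded_meas g -> bounded_meas (fun z => f z - g z).
Proof.
move=> bf bg; have -> : (fun z => f z - g z) = (fun z => f z + -1 * g z).
  by apply/funext => z; rewrite mulN1r.
by apply: bounded_measD => //; exact: bounded_measZ.
Qed.

Lemma bounded_meas_sum (I : Type) (s : seq I) (P : pred I)
    (F : I -> plane R -> R) :
  (forall i, bounded_meas (F i)) ->
  bounded_meas (fun z => \sum_(i <- s | P i) F i z).
Proof.
move=> bF; elim: s => [|i s IH].
  rewrite [X in bounded_meas X](_ : _ = cst 0); first exact: bounded_meas_cst.
  by apply/funext => z; rewrite big_nil.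
case Pi : (P i).
  rewrite [X in bounded_meas X](_ : _ =
      fun z => F i z + \sum_(j <- s | P j) F j z).
    by apply: bounded_measD.
  by apply/funext => z; rewrite big_cons Pi.
rewrite [X in bounded_meas X](_ : _ = fun z => \sum_(j <- s | P j) F j z) //.
by apply/funext => z; rewrite big_cons Pi.
Qed.

Lemma bounded_meas_prod (I : Type) (s : seq I) (F : I -> plane R -> R) :
  (forall i, bounded_meas (F i)) ->
  bounded_meas (fun z => \prod_(i <- s) F i z).
Proof.
move=> bF; elim: s => [|i s IH].
  rewrite [X in bounded_meas X](_ : _ = cst 1); first exact: bounded_meas_cst.
  by apply/funext => z; rewrite big_nil.
rewrite [X in bounded_meas X](_ : _ = fun z => F i z * \prod_(j <- s) F j z).
  by apply: bounded_measM.
by apply/funext => z; rewrite big_cons.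
Qed.

Lemma bounded_meas_lincomb n (g : 'I_n -> R) (u : 'I_n -> plane R -> R) :
  (forall i, bounded_meas (u i)) -> bounded_meas (lincomb g u).
Proof. by move=> bu; apply: bounded_meas_sum => i; exact: bounded_measZ. Qed.

Lemma bounded_meas_integrable f : bounded_meas f ->
  lebesgue2.-integrable unit_square (EFin \o f).
Proof.
move=> [mf [M fM]]; apply: measurable_bounded_integrable => //.
- exact: measurable_unit_square.
- by rewrite [X in (X < _)%E]lebesgue2_unit_square ltry.
- exists M; split; first exact: num_real.
  by move=> N MN z /fM/le_trans; apply; exact: ltW.
Qed.

(** * The inner product and the norm *)

Lemma L2innerC f g : L2inner f g = L2inner g f.
Proof. by apply: eq_Rintegral => z _; rewrite mulrC. Qed.

Lemma L2inner_ge0 f : 0 <= L2inner f f.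
Proof. by apply: Rintegral_ge0 => z _; rewrite -expr2 sqr_ge0. Qed.

Lemma L2inner_linear a b f g h :
  bounded_meas f -> bounded_meas g -> bounded_meas h ->
  L2inner (fun z => a * f z + b * g z) h = a * L2inner f h + b * L2inner g h.
Proof.
move=> bf bg bh; have mD := measurable_unit_square.
have bfh := bounded_measM bf bh; have bgh := bounded_measM bg bh.
rewrite /L2inner -!RintegralZl //; try exact: bounded_meas_integrable.
rewrite -RintegralD //;
  try by apply: bounded_meas_integrable; exact: bounded_measZ.
by apply: eq_Rintegral => z _; ring.
Qed.

Lemma L2innerBl f g h :
  bounded_meas f -> bounded_meas g -> bounded_meas h ->
  L2inner (f \- g) h = L2inner f h - L2inner g h.
Proof.
move=> bf bg bh; rewrite -[L2inner f h]mul1r -mulN1r -L2inner_linear //.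
by apply: eq_Rintegral => z _ /=; ring.
Qed.

Lemma L2inner_lincombl n (g : 'I_n -> R) (u : 'I_n -> plane R -> R) h :
  (forall i, bounded_meas (u i)) -> bounded_meas h ->
  L2inner (lincomb g u) h = \sum_i g i * L2inner (u i) h.
Proof.
move=> bu bh; rewrite /lincomb; elim: (index_enum _) => [|i s IH].
  rewrite big_nil /L2inner (_ : (fun _ => _) = cst 0); last first.
    by apply/funext => z; rewrite big_nil mul0r.
  by rewrite Rintegral_cst ?mul0r //; exact: measurable_unit_square.
rewrite big_cons -IH -[X in _ + X]mul1r -L2inner_linear //.
  by apply: eq_Rintegral => z _; rewrite big_cons mul1r.
by apply: bounded_meas_sum => j; exact: bounded_measZ.
Qed.

Lemma L2norm_ge0 f : 0 <= L2norm f.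
Proof. by apply: fine_ge0; exact: Lnorm_ge0. Qed.

(** The definition of [L2norm] sends an infinite norm to [0], so this identity
    relies on the finiteness of the integral. *)
Lemma L2norm_sqr f : bounded_meas f -> L2norm f ^+ 2 = L2inner f f.
Proof.
move=> bf.
have /integrable_fin_num := bounded_meas_integrable (bounded_measM bf bf).
move=> /(_ measurable_unit_square) fin.
have e : ('N[lebesgue2]_2%:E [EFin \o (f \_ unit_square)] `^ 2 =
          \int[lebesgue2]_(z in unit_square) (f z * f z)%:E)%E.
  rewrite poweR_Lnorm // [RHS]integral_mkcond; apply: eq_integral => z _ /=.
  rewrite /patch; case: ifP => _ /=.
    by rewrite powR_mulrn // real_normK ?num_real // expr2.
  by rewrite normr0 powR0.
have {}fin : ('N[lebesgue2]_2%:E [EFin \o (f \_ unit_square)] `^ 2)%E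
    \is a fin_num by rewrite e.
rewrite /L2inner /Rintegral -e /L2norm; move: fin => {e}.
have : (0 <= 'N[lebesgue2]_2%:E [EFin \o (f \_ unit_square)])%E.
  exact: Lnorm_ge0.
case: ('N[lebesgue2]_2%:E [_]%E) => [r r0 _|_ /=|//] /=.
  by rewrite powR_mulrn // -lee_fin.
by rewrite pnatr_eq0.
Qed.

(** The quadratic form [s, t |-> |s f + t g|^2] is nonnegative; it is evaluated
    at the minimizing direction, with a separate argument when [g] is null,
    where that direction degenerates. *)
Lemma cauchy_schwarz_sqr f g : bounded_meas f -> bounded_meas g ->
  L2inner f g ^+ 2 <= L2inner f f * L2inner g g.
Proof.
move=> bf bg.
have q s t : 0 <= s ^+ 2 * L2inner f f + 2 * s * t * L2inner f g +
                  t ^+ 2 * L2inner g g.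
  have bh : bounded_meas (fun z => s * f z + t * g z).
    by apply: bounded_measD; exact: bounded_measZ.
  have := L2inner_ge0 (fun z => s * f z + t * g z).
  rewrite L2inner_linear // ![L2inner _ (fun z => _ + _)]L2innerC.
  rewrite !L2inner_linear // [L2inner g f]L2innerC => h.
  by apply: le_trans h _; lra.
have [c0|c0] := eqVneq (L2inner g g) 0.
  have [->|b0] := eqVneq (L2inner f g) 0; first by rewrite c0 expr0n /= mulr0.
  (* For a null [g] the form is affine in [t]; this [t] makes it equal to -1. *)
  have := q 1 (- (L2inner f f + 1) / (2 * L2inner f g)).
  rewrite c0 mulr0 addr0 expr1n mul1r mulr1.
  have -> : 2 * (- (L2inner f f + 1) / (2 * L2inner f g)) * L2inner f g =
    - (L2inner f f + 1) by field.
  by lra.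
have c1 : 0 < L2inner g g by rewrite lt_def c0 L2inner_ge0.
have := q (L2inner g g) (- L2inner f g).
move=> h; rewrite -subr_ge0 -(pmulr_rge0 _ c1).
by apply: le_trans h _; rewrite le_eqVlt; apply/orP; left; apply/eqP; ring.
Qed.

Lemma cauchy_schwarz f g : bounded_meas f -> bounded_meas g ->
  `|L2inner f g| <= L2norm f * L2norm g.
Proof.
move=> bf bg; rewrite -(ler_pXn2r (ltn0Sn 1)) ?nnegrE ?mulr_ge0 ?L2norm_ge0 //.
by rewrite exprMn !L2norm_sqr // real_normK ?num_real // cauchy_schwarz_sqr.
Qed.

Lemma L2norm_comb_sqr a b f g : bounded_meas f -> bounded_meas g ->
  L2norm (fun z => a * f z + b * g z) ^+ 2 =
  a ^+ 2 * L2norm f ^+ 2 + 2 * a * b * L2inner f g + b ^+ 2 * L2norm g ^+ 2.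
Proof.
move=> bf bg.
have bh : bounded_meas (fun z => a * f z + b * g z).
  by apply: bounded_measD; exact: bounded_measZ.
rewrite !L2norm_sqr // L2inner_linear // ![L2inner _ (fun z => _ + _)]L2innerC.
rewrite !L2inner_linear // [L2inner g f]L2innerC; ring.
Qed.

Lemma L2norm_comb_le a b f g : bounded_meas f -> bounded_meas g ->
  L2norm (fun z => a * f z + b * g z) <= `|a| * L2norm f + `|b| * L2norm g.
Proof.
move=> bf bg; have nf := L2norm_ge0 f; have ng := L2norm_ge0 g.
rewrite -(ler_pXn2r (ltn0Sn 1)) ?nnegrE ?L2norm_ge0 ?addr_ge0 ?mulr_ge0 //.
rewrite L2norm_comb_sqr // sqrrD !exprMn !real_normK ?num_real //.
rewrite lerD2r lerD2l.
have -> : 2 * a * b * L2inner f g = (a * b * L2inner f g) *+ 2 by ring.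
rewrite lerMn2r /=; apply: le_trans (ler_norm _) _.
rewrite !normrM mulrACA; apply: ler_wpM2l; first by rewrite mulr_ge0.
exact: cauchy_schwarz.
Qed.

Lemma eq_L2norm f g : (forall z, unit_square z -> f z = g z) ->
  L2norm f = L2norm g.
Proof.
move=> fg; congr (fine _); apply: eq_Lnorm => z /=; rewrite /patch.
by case: ifPn => // /set_mem /fg ->.
Qed.

Lemma L2normZ a f : bounded_meas f ->
  L2norm (fun z => a * f z) = `|a| * L2norm f.
Proof.
move=> bf; apply/eqP; rewrite -(eqrXn2 (ltn0Sn 1)) ?mulr_ge0 ?L2norm_ge0 //.
rewrite exprMn real_normK ?num_real // -[X in _ == X]addr0.
have := L2norm_comb_sqr a 0 bf bf.
rewrite mulr0 !mul0r expr0n /= mul0r !addr0 => <-.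
by apply/eqP; congr (_ ^+ 2); apply: eq_L2norm => z _; rewrite mul0r addr0.
Qed.

(** The unit square has measure [1], so the uniform norm dominates. *)
Lemma L2norm_le M f : bounded_meas f ->
  (forall z, unit_square z -> `|f z| <= M) -> L2norm f <= M.
Proof.
move=> bf fM; have mD := measurable_unit_square.
have M0 : 0 <= M.
  have D0 : @unit_square R (0, 0).
    by split; rewrite /= in_itv /= lexx ler01.
  by apply: le_trans (fM _ D0).
rewrite -(ler_pXn2r (ltn0Sn 1)) ?nnegrE ?L2norm_ge0 // L2norm_sqr //.
have -> : M ^+ 2 = \int[lebesgue2]_(z in @unit_square R) (cst (M ^+ 2)) z.
  by rewrite Rintegral_cst // [X in fine X]lebesgue2_unit_square mulr1.
apply: le_Rintegral => //.
- by apply: bounded_meas_integrable; exact: bounded_measM.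
- by apply: bounded_meas_integrable; exact: bounded_meas_cst.
- move=> z Dz; rewrite -expr2 -real_normK ?num_real // ler_pXn2r ?nnegrE //.
  exact: fM.
Qed.

Lemma L2norm_eq0 f : bounded_meas f -> L2norm f = 0 -> L2eq f (cst 0).
Proof.
move=> bf f0; have mD := measurable_unit_square.
have bff := bounded_measM bf bf.
have /measurable_EFinP mff := bff.1.
have i0 : (\int[lebesgue2]_(z in unit_square) (f z * f z)%:E = 0)%E.
  have fin := integrable_fin_num mD (bounded_meas_integrable bff).
  have := L2norm_sqr bf; rewrite f0 expr0n => /esym e0.
  by rewrite -(fineK fin); exact: (congr1 EFin e0).
have : ae_eq lebesgue2 unit_square (EFin \o (fun z => f z * f z)) (cst 0%E).
  apply/ae_eq_integral_abs => //; rewrite -i0; apply: eq_integral => z _ /=.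
  by rewrite ger0_norm // -expr2 sqr_ge0.
apply: filterS => z /= + Dz => /(_ Dz) [] /eqP.
by rewrite mulf_eq0 orbb => /eqP.
Qed.

End SquareIntegration.

(** * Projection onto the span of a free family *)

Section Spans.
Context {R : realType}.
Implicit Types (f g h e s : plane R -> R) (S : set (plane R -> R)) (a b : R).

Definition free_family n (u : 'I_n -> plane R -> R) : Prop :=
  forall g : 'I_n -> R, L2eq (lincomb g u) (cst 0) -> forall i, g i = 0.

Definition gram n (u : 'I_n -> plane R -> R) : 'M[R]_n :=
  \matrix_(i, j) L2inner (u i) (u j).

Lemma lincomb_comb n (u : 'I_n -> plane R -> R) a b (g g' : 'I_n -> R) :
  lincomb (fun i => a * g i + b * g' i) u =
  fun z => a * lincomb g u z + b * lincomb g' u z.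
Proof.
apply/funext => z; rewrite /lincomb !mulr_sumr -big_split /=.
by apply: eq_bigr => i _; rewrite mulrDl !mulrA.
Qed.

Lemma linspan_comb n (u : 'I_n -> plane R -> R) a b f g :
  linspan u f -> linspan u g -> linspan u (fun z => a * f z + b * g z).
Proof.
move=> [c _ <-] [d _ <-]; exists (fun i => a * c i + b * d i) => //.
exact: lincomb_comb.
Qed.

Lemma linspanB n (u : 'I_n -> plane R -> R) f g :
  linspan u f -> linspan u g -> linspan u (f \- g).
Proof.
move=> uf ug; have := linspan_comb 1 (-1) uf ug.
by congr (linspan u _); apply/funext => z /=; ring.
Qed.

Section BoundedFamily.
Context {n : nat} (u : 'I_n -> plane R -> R).
Hypothesis bu : forall i, bounded_meas (u i).

Lemma bounded_meas_linspan h : linspan u h -> bounded_meas h.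
Proof. by move=> [g _ <-]; exact: bounded_meas_lincomb. Qed.

Lemma mul_gram (g : 'rV[R]_n) k :
  (g *m gram u) 0 k = L2inner (lincomb (g 0) u) (u k).
Proof.
by rewrite mxE L2inner_lincombl //; apply: eq_bigr => i _; rewrite mxE.
Qed.

(** Gives both properties of a projection at once: [h] minimizes the distance
    to [f] in the span, and no [g] in the span is farther from [h] than from
    [f]. *)
Lemma pythagoras f g h : bounded_meas f -> is_orth_proj f (linspan u) h ->
  linspan u g ->
  L2norm (f \- g) ^+ 2 = L2norm (f \- h) ^+ 2 + L2norm (h \- g) ^+ 2.
Proof.
move=> bf [uh orth] ug; have bh := bounded_meas_linspan uh.
have bg := bounded_meas_linspan ug.
have e : L2norm (f \- g) =
         L2norm (fun z => 1 * (f \- h) z + 1 * (h \- g) z).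
  by apply: eq_L2norm => z _ /=; ring.
rewrite e L2norm_comb_sqr; try exact: bounded_measB.
rewrite orth; last exact: linspanB.
ring.
Qed.

(** The set [S] may be smaller than the span: a cone containing the projection
    is exactly as far from [f] as the whole span. *)
Lemma L2dist_orth_proj S f h : bounded_meas f ->
  is_orth_proj f (linspan u) h -> S h -> S `<=` linspan u ->
  L2dist f S = L2norm (f \- h).
Proof.
move=> bf ph Sh Su; apply/eqP; rewrite eq_le; apply/andP; split.
  apply: ge_inf; last by exists h.
  by exists 0 => _ [k _ <-]; exact: L2norm_ge0.
apply: lb_le_inf; first by exists (L2norm (f \- h)), h.
move=> _ [k Sk <-]; rewrite -(ler_pXn2r (ltn0Sn 1)) ?nnegrE ?L2norm_ge0 //.
by rewrite (pythagoras bf ph (Su _ Sk)) lerDl sqr_ge0.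
Qed.

Hypothesis fu : free_family u.

(** A vector [g] in the kernel satisfies [g G g^T = 0], which is the squared
    norm of the combination with coefficients [g]; freeness then kills [g]. *)
Lemma gram_unit : gram u \in unitmx.
Proof.
rewrite -row_free_unit; apply: inj_row_free => g g0.
have bg := bounded_meas_lincomb (g 0) bu.
suff /(L2norm_eq0 bg)/fu gz : L2norm (lincomb (g 0) u) = 0.
  by apply/rowP => i; rewrite gz mxE.
apply/eqP; rewrite -sqrf_eq0 L2norm_sqr //.
rewrite L2inner_lincombl //; apply/eqP; apply: big1 => i _.
by rewrite L2innerC -mul_gram g0 mxE mulr0.
Qed.

(** The coefficients of the projection solve the normal equations. *)
Lemma exists_orth_proj f : bounded_meas f ->
  exists h, is_orth_proj f (linspan u) h.
Proof.
move=> bf; pose y : 'rV[R]_n := \row_i L2inner f (u i).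
pose g := y *m invmx (gram u).
have bg := bounded_meas_lincomb (g 0) bu.
exists (lincomb (g 0) u); split; first by exists (g 0).
move=> _ [c _ <-].
rewrite L2innerC L2inner_lincombl //; last exact: bounded_measB.
apply: big1 => i _.
rewrite L2innerC L2innerBl // -mul_gram mulmxKV ?gram_unit //.
by rewrite mxE subrr mulr0.
Qed.

(** Multiplying by the Gram matrix turns coefficients into inner products with
    the [u i], which Cauchy-Schwarz controls; its inverse recovers them. *)
Lemma coef_le_L2norm :
  exists2 C : R, 0 < C & forall (g : 'I_n -> R) k,
    `|g k| <= C * L2norm (lincomb g u).
Proof.
pose G := invmx (gram u).
pose c k i := L2norm (u i) * `|G i k|.
have c0 k i : 0 <= c k i by rewrite mulr_ge0 ?L2norm_ge0.
have s0 k : 0 <= \sum_i c k i by apply: sumr_ge0.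
exists (1 + \sum_k \sum_i c k i) => [|g k].
  by apply: ltr_pwDl => //; apply: sumr_ge0.
have bg := bounded_meas_lincomb g bu.
apply: (@le_trans _ _ ((\sum_i c k i) * L2norm (lincomb g u))); last first.
  rewrite ler_wpM2r ?L2norm_ge0 // ler_wpDl //.
  by rewrite [leRHS](bigD1 k) //= lerDl sumr_ge0.
have gE : \row_i g i = (\row_i g i *m gram u) *m G by rewrite mulmxK ?gram_unit.
have -> : g k = (\row_i g i *m gram u *m G) 0 k by rewrite -gE mxE.
rewrite mxE mulr_suml; apply: le_trans (ler_norm_sum _ _ _) _.
apply: ler_sum => i _; rewrite normrM mul_gram.
have -> : lincomb ((\row_i0 g i0) 0) u = lincomb g u.
  by congr (lincomb _ u); apply/funext => j; rewrite mxE.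
rewrite /c mulrAC; apply: ler_wpM2r => //.
by rewrite mulrC; exact: cauchy_schwarz.
Qed.

Lemma L2dist_linspanE f : bounded_meas f ->
  exists2 h, linspan u h & L2dist f (linspan u) = L2norm (f \- h).
Proof.
move=> bf; have [h ph] := exists_orth_proj bf.
by exists h; [case: ph|apply: (L2dist_orth_proj bf ph) => //; case: ph].
Qed.

Lemma L2dist_linspan_le f h : linspan u h ->
  L2dist f (linspan u) <= L2norm (f \- h).
Proof.
move=> uh; apply: ge_inf; last by exists h.
by exists 0 => _ [k _ <-]; exact: L2norm_ge0.
Qed.

Lemma L2dist_linspan_gt0 f : bounded_meas f -> ~ L2mem f (linspan u) ->
  0 < L2dist f (linspan u).
Proof.
move=> bf nf; have [h uh ->] := L2dist_linspanE bf.
rewrite lt_def L2norm_ge0 andbT; apply/eqP => f0; apply: nf; exists h => //.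
have := L2norm_eq0 (bounded_measB bf (bounded_meas_linspan uh)) f0.
by apply: filterS => z /= + Dz => /(_ Dz) /subr0_eq.
Qed.

(** Distance to a span is invariant under translations in the span, homogeneous
    and 1-Lipschitz. Applied with the roles of [f] and [e] exchanged and
    [a^-1] for [a], it also bounds the distance of [f] from below. *)
Lemma L2dist_linspan_affine a f e s :
  bounded_meas f -> bounded_meas e -> linspan u s ->
  L2dist f (linspan u) <=
    `|a| * L2dist e (linspan u) + L2norm (fun z => f z - (a * e z + s z)).
Proof.
move=> bf be us; have [h uh ->] := L2dist_linspanE be.
have bs := bounded_meas_linspan us; have bh := bounded_meas_linspan uh.
have uah := linspan_comb a 1 uh us.
apply: le_trans (L2dist_linspan_le f uah) _.
rewrite (_ : L2norm (f \- _) = L2norm (fun z => a * (e \- h) z +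
    1 * (f z - (a * e z + s z)))); last by apply: eq_L2norm => z _ /=; ring.
apply: le_trans (L2norm_comb_le _ _ _ _) _; first exact: bounded_measB.
  apply: bounded_measB => //.
  by apply: bounded_measD => //; exact: bounded_measZ.
by rewrite normr1 mul1r.
Qed.

(** The projection of [f] is no farther from [lincomb g u] than [f] is, so its
    coefficients are close to [g]. *)
Lemma orth_proj_coef_le C f (b g : 'I_n -> R) k :
  (forall c i, `|c i| <= C * L2norm (lincomb c u)) -> 0 <= C ->
  bounded_meas f -> is_orth_proj f (linspan u) (lincomb b u) ->
  `|b k - g k| <= C * L2norm (f \- lincomb g u).
Proof.
move=> hC C0 bf pb.
have := hC (fun i => 1 * b i + -1 * g i) k; rewrite lincomb_comb mul1r mulN1r.
move=> /le_trans; apply; apply: ler_wpM2l => //.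
have ug : linspan u (lincomb g u) by exists g.
rewrite -(ler_pXn2r (ltn0Sn 1)) ?nnegrE ?L2norm_ge0 // (pythagoras bf pb ug).
rewrite [X in X ^+ 2 <= _](_ : _ = L2norm (lincomb b u \- lincomb g u)).
  by rewrite lerDr sqr_ge0.
by apply: eq_L2norm => z _ /=; ring.
Qed.

Lemma L2dist_second_order M r f e s : 0 < r ->
  bounded_meas f -> bounded_meas e -> linspan u s ->
  (forall z, unit_square z ->
     `|f z - (r * s z - r ^+ 2 * e z)| <= M * r ^+ 3) ->
  `|L2dist f (linspan u) - r ^+ 2 * L2dist e (linspan u)| <= M * r ^+ 3.
Proof.
move=> r0 bf be us H; have bs := bounded_meas_linspan us.
have r2 : 0 < r ^+ 2 by rewrite exprn_gt0.
have i0 : 0 <= (r ^+ 2)^-1 by rewrite invr_ge0 ltW.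
have ur b : linspan u (fun z => b * s z).
  have := linspan_comb b 0 us us; congr (linspan u _).
  by apply/funext => z; ring.
rewrite ler_norml lerBrDr lerBlDl; apply/andP; split.
  have := L2dist_linspan_affine (- (r ^+ 2)^-1) be bf (ur r^-1).
  rewrite (_ : L2norm _ = L2norm (fun z =>
      (r ^+ 2)^-1 * (f z - (r * s z - r ^+ 2 * e z)))); last first.
    by apply: eq_L2norm => z _; field; rewrite gt_eqF.
  have bF : bounded_meas (fun z => f z - (r * s z - r ^+ 2 * e z)).
    by do !apply: bounded_measB => //; exact: bounded_measZ.
  rewrite L2normZ // normrN ger0_norm //.
  rewrite -mulrDr mulrC.
  rewrite ler_pdivlMr // => h; have := L2norm_le bF H; lra.
have bF : bounded_meas (fun z => f z - (- r ^+ 2 * e z + r * s z)).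
  by apply: bounded_measB => //; apply: bounded_measD; exact: bounded_measZ.
apply: le_trans (L2dist_linspan_affine (- r ^+ 2) bf be (ur r)) _.
rewrite normrN (ger0_norm (ltW r2)) lerD2l; apply: L2norm_le => // z Dz.
by have := H z Dz; congr (`|_| <= _); ring.
Qed.

End BoundedFamily.

(** * The intercept as an additional template *)

Section WithOne.
Context {J : nat}.
Implicit Types (w : 'I_J -> plane R -> R).

Definition with_one w : 'I_J.+1 -> plane R -> R :=
  fun i => oapp w (cst 1) (unlift ord0 i).

Lemma affcombE c (g : 'I_J -> R) w :
  affcomb c g w = lincomb (fun i => oapp g c (unlift ord0 i)) (with_one w).
Proof.
apply/funext => z; rewrite /affcomb /lincomb /with_one big_ord_recl unlift_none.
by rewrite /= mulr1; congr (_ + _); apply: eq_bigr => i _; rewrite liftK.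
Qed.

Lemma intercept_spanE w : intercept_span w = linspan (with_one w).
Proof.
apply/seteqP; split=> [_ [c _ [g _ <-]]|_ [g _ <-]].
  by rewrite affcombE; eexists.
exists (g ord0) => //; exists (fun j => g (lift ord0 j)) => //.
rewrite affcombE; congr (lincomb _ _); apply/funext => i.
by case: unliftP => [j ->|->].
Qed.

Lemma free_with_oneE w : free_with_one w -> free_family (with_one w).
Proof.
move=> fw g.
have -> : lincomb g (with_one w) =
          affcomb (g ord0) (fun j => g (lift ord0 j)) w.
  rewrite affcombE; congr (lincomb _ _); apply/funext => i.
  by case: unliftP => [j ->|->].
by move=> /fw [g0 gl] i; case: (unliftP ord0 i) => [j ->|->].
Qed.

Lemma free_with_one_free w : free_with_one w -> free_family w.
Proof.
move=> fw g g0; have : L2eq (affcomb 0 g w) (cst 0).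
  by apply: filterS g0 => z + Dz => /(_ Dz); rewrite /affcomb add0r.
by move=> /fw [].
Qed.

Lemma bounded_meas_with_one w : (forall j, bounded_meas (w j)) ->
  forall i, bounded_meas (with_one w i).
Proof.
move=> bw i; rewrite /with_one; case: unliftP => [j|] _ //=.
exact: bounded_meas_cst.
Qed.

Lemma lincomb_scaled (r : R) (g : 'I_J -> R) w :
  lincomb g (scaled r w) = lincomb (fun j => r * g j) w.
Proof.
apply/funext => z; apply: eq_bigr => j _; rewrite /scaled; ring.
Qed.

Lemma affcomb_scaled (r c : R) (g : 'I_J -> R) w :
  affcomb c g (scaled r w) = affcomb c (fun j => r * g j) w.
Proof.
apply/funext => z; congr (_ + _); apply: eq_bigr => j _; rewrite /scaled; ring.
Qed.

Lemma linspan_scaled (r : R) w : r != 0 -> linspan (scaled r w) = linspan w.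
Proof.
move=> r0; apply/seteqP; split=> [_ [g _ <-]|_ [g _ <-]].
  by rewrite lincomb_scaled; eexists.
exists (fun j => r^-1 * g j) => //; rewrite lincomb_scaled.
by congr (lincomb _ _); apply/funext => j; rewrite mulrA divff // mul1r.
Qed.

Lemma intercept_span_scaled (r : R) w : r != 0 ->
  intercept_span (scaled r w) = intercept_span w.
Proof.
move=> r0; apply/seteqP; split=> [_ [c _ [g _ <-]]|_ [c _ [g _ <-]]].
  by rewrite affcomb_scaled; exists c => //; eexists.
exists c => //; exists (fun j => r^-1 * g j) => //; rewrite affcomb_scaled.
by congr (affcomb _ _ _); apply/funext => j; rewrite mulrA divff // mul1r.
Qed.

End WithOne.

End Spans.

(** * Third-order expansion of the noisy-or *)

Section NoisyOrExpansion.
Context {R : realType}.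

Lemma pair_sum_recr n (x : 'I_n.+1 -> R) :
  \sum_(j < n.+1) \sum_(k < n.+1 | (j < k)%N) x j * x k =
  \sum_(j < n) \sum_(k < n | (j < k)%N)
     x (widen_ord (leqnSn n) j) * x (widen_ord (leqnSn n) k) +
  (\sum_(j < n) x (widen_ord (leqnSn n) j)) * x ord_max.
Proof.
rewrite big_ord_recr /= [X in _ + X]big1 ?addr0; last first.
  by move=> k; rewrite ltnNge -ltnS ltn_ord.
rewrite mulr_suml -big_split; apply: eq_bigr => j _ /=.
by rewrite big_mkcond big_ord_recr /= ltn_ord -big_mkcond.
Qed.

(** Induction on the number of agents. With [P], [S], [E] the product, sum and
    pair sum of the first [n] agents and [t] the new value, the error for
    [n.+1] agents is [(1 - r t)] times the old one plus [r ^+ 3 * t * E]. The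
    bounds on [S] and [E] are carried along to control this extra term. *)
Lemma noisy_or_third_order n : exists2 K : R, 0 <= K &
  forall (r : R) (x : 'I_n -> R), 0 <= r <= 1 -> (forall j, 0 <= x j <= 1) ->
  [/\ `|\sum_(j < n) x j| <= K,
      `|\sum_(j < n) \sum_(k < n | (j < k)%N) x j * x k| <= K &
      `|1 - \prod_(j < n) (1 - r * x j) - (r * \sum_(j < n) x j -
        r ^+ 2 * \sum_(j < n) \sum_(k < n | (j < k)%N) x j * x k)|
      <= K * r ^+ 3].
Proof.
elim: n => [|n [K K0 IH]].
  exists 0 => // r x _ _; rewrite !big_ord0.
  by rewrite (_ : 1 - 1 - _ = 0) ?normr0 ?mul0r //; ring.
exists (2 * K + 1) => [|r x r01 x01]; first lra.
pose y j := x (widen_ord (leqnSn n) j).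
have [hS hE hP] := IH r y r01 (fun j => x01 _).
have /andP[r0 r1] := r01; have /andP[t0 t1] := x01 ord_max.
rewrite pair_sum_recr !big_ord_recr /=.
move: hS hE hP; rewrite -/(y _).
set S := \sum_(j < n) y j; set E := \sum_(j < n) \sum_(k < n | _) y j * y k.
set P := \prod_(j < n) (1 - r * y j); set t := x ord_max.
rewrite -/t in t0 t1.
move=> hS hE hP.
have hSt : `|S * t| <= K.
  by rewrite normrM -[leRHS]mulr1 ler_pM // ger0_norm.
split.
- apply: le_trans (ler_normD _ _) _; rewrite [`|t|]ger0_norm //; lra.
- apply: le_trans (ler_normD _ _) _; lra.
- have -> : 1 - P * (1 - r * t) - (r * (S + t) - r ^+ 2 * (E + S * t)) =
    (1 - P - (r * S - r ^+ 2 * E)) * (1 - r * t) + r ^+ 3 * (t * E) by ring.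
  apply: le_trans (ler_normD _ _) _.
  rewrite [`|_ * (1 - _)|]normrM [`|r ^+ 3 * _|]normrM [`|t * _|]normrM.
  have rt0 : 0 <= r * t by rewrite mulr_ge0.
  have rt1 : r * t <= 1 by rewrite mulr_ile1.
  have r3 : 0 <= r ^+ 3 by rewrite exprn_ge0.
  have h1 : `|1 - P - (r * S - r ^+ 2 * E)| * `|1 - r * t| <= K * r ^+ 3.
    by rewrite -[leRHS]mulr1 ler_pM // ger0_norm; lra.
  have h2 : `|r ^+ 3| * (`|t| * `|E|) <= r ^+ 3 * K.
    rewrite [`|r ^+ 3|]ger0_norm // ler_wpM2l // -[K]mul1r ler_pM //.
    by rewrite ger0_norm.
  lra.
Qed.

End NoisyOrExpansion.

(** * From distances to squared distances *)

Section Asymptotics.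
Context {R : realType}.

Lemma sqr_relative_error (x d r M : R) : 0 < d -> 0 < r <= 1 -> 0 <= M ->
  `|x - r ^+ 2 * d| <= M * r ^+ 3 ->
  exists2 t : R, `|t| <= ((2 * M * d + M ^+ 2) / d ^+ 2) * r &
    x ^+ 2 = r ^+ 4 * d ^+ 2 * (1 + t).
Proof.
move=> d0 /andP[r0 r1] M0 h; set th := x - r ^+ 2 * d in h.
have q0 : 0 < r ^+ 4 * d ^+ 2 by rewrite mulr_gt0 ?exprn_gt0.
exists ((x ^+ 2 - r ^+ 4 * d ^+ 2) / (r ^+ 4 * d ^+ 2)); last first.
  by field; rewrite !gt_eqF.
rewrite normrM normfV (gtr0_norm q0) ler_pdivrMr //.
have -> : (2 * M * d + M ^+ 2) / d ^+ 2 * r * (r ^+ 4 * d ^+ 2) =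
  (M * r ^+ 3) * (2 * r ^+ 2 * d + M * r ^+ 2) by field; rewrite gt_eqF.
have -> : x ^+ 2 - r ^+ 4 * d ^+ 2 = th * (2 * r ^+ 2 * d + th).
  by rewrite /th; ring.
rewrite normrM ler_pM //; apply: le_trans (ler_normD _ _) _.
rewrite ger0_norm; last by rewrite !mulr_ge0 ?exprn_ge0 ?ltW.
rewrite lerD2l; apply: le_trans h _; apply: ler_wpM2l => //.
by rewrite exprS ler_piMl // exprn_ge0 // ltW.
Qed.

Lemma asymp_sqr (d : R -> R) (c C r0 : R) : 0 < c -> 0 < C -> 0 < r0 ->
  (forall r, 0 < r <= r0 -> c * r <= d r <= C * r) ->
  asymp (fun r => d r ^+ 2) (fun r => r ^+ 2).
Proof.
move=> c0 C0 r00 H; exists (c ^+ 2), (C ^+ 2); split; try exact: exprn_gt0.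
near=> r.
have r0' : 0 < r by near: r; exact: nbhs_right_gt.
have rr0 : r <= r0 by near: r; exact: nbhs_right_le.
have /andP[h1 h2] : c * r <= d r <= C * r by apply: H; rewrite r0' rr0.
have cr : 0 <= c * r by rewrite mulr_ge0 ?ltW.
have dr : 0 <= d r by exact: le_trans h1.
rewrite ler_pdivlMr ?ler_pdivrMr ?exprn_gt0 // -!exprMn.
by rewrite !ler_pXn2r ?nnegrE ?h1 // (le_trans dr h2).
Unshelve. all: by end_near. Qed.

End Asymptotics.

(** * The first-order floor of the hulls *)

Section NoisyOr.
Context {R : realType} {J : nat} (wt : 'I_J -> plane R -> R).
Hypothesis wt_meas : forall j, measurable_fun unit_square (wt j).
Hypothesis wt_01 : forall j z, unit_square z -> 0 <= wt j z <= 1.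

Lemma bounded_meas_templates j : bounded_meas (wt j).
Proof.
split; [exact: wt_meas|exists 1 => z /(wt_01 j) /andP[? ?]].
by rewrite ger0_norm.
Qed.

Lemma bounded_meas_noisy_or r : bounded_meas (noisy_or (scaled r wt)).
Proof.
apply: bounded_measB; first exact: bounded_meas_cst.
apply: bounded_meas_prod => j; apply: bounded_measB.
  exact: bounded_meas_cst.
by apply: bounded_measZ; exact: bounded_meas_templates.
Qed.

Lemma bounded_meas_pair_interaction : bounded_meas (pair_interaction wt).
Proof.
apply: bounded_meas_sum => j; apply: bounded_meas_sum => k.
by apply: bounded_measM; exact: bounded_meas_templates.
Qed.

Let s := lincomb (fun=> 1) wt.

Lemma noisy_or_expansion : exists2 K : R, 0 < K &
  forall r, 0 < r <= 1 ->
  [/\ forall z, unit_square z -> `|noisy_or (scaled r wt) z -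
        (r * s z - r ^+ 2 * pair_interaction wt z)| <= K * r ^+ 3,
      forall z, unit_square z -> `|noisy_or (scaled r wt) z| <= K * r &
      L2norm (noisy_or (scaled r wt) \- lincomb (fun=> r) wt) <= K * r ^+ 2].
Proof.
have [K K0 H] := @noisy_or_third_order R J.
exists (3 * K + 1) => [|r /andP[r0 r1]]; first lra.
have r01 : 0 <= r <= 1 by rewrite ltW.
have r2 : 0 <= r ^+ 2 by rewrite exprn_ge0 // ltW.
have r3 : 0 <= r ^+ 3 by rewrite exprn_ge0 // ltW.
have r21 : r ^+ 2 <= r by rewrite expr2 ler_piMl // ltW.
have r32 : r ^+ 3 <= r ^+ 2 by rewrite exprS ler_piMl.
have Kr : K * r ^+ 3 <= K * r ^+ 2 by rewrite ler_wpM2l.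
have Kr3 : 0 <= K * r ^+ 3 by rewrite mulr_ge0.
have Kr' : K * r ^+ 2 <= K * r by rewrite ler_wpM2l.
have sE z : s z = \sum_(j < J) wt j z.
  by apply: eq_bigr => j _; rewrite mul1r.
have third z : unit_square z -> [/\ `|s z| <= K, `|pair_interaction wt z| <= K &
    `|noisy_or (scaled r wt) z -
        (r * s z - r ^+ 2 * pair_interaction wt z)| <= K * r ^+ 3].
  move=> Dz; have [hS hE hP] := H r (wt ^~ z) r01 (fun j => wt_01 j Dz).
  by rewrite sE.
have second z : unit_square z -> `|noisy_or (scaled r wt) z - r * s z| <=
    2 * K * r ^+ 2.
  move=> Dz; have [_ hE hP] := third z Dz.
  have -> : noisy_or (scaled r wt) z - r * s z = (noisy_or (scaled r wt) z -
    (r * s z - r ^+ 2 * pair_interaction wt z)) -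
    r ^+ 2 * pair_interaction wt z.
    by ring.
  apply: le_trans (ler_normB _ _) _; rewrite normrM [`|r ^+ 2|]ger0_norm //.
  have : r ^+ 2 * `|pair_interaction wt z| <= r ^+ 2 * K by rewrite ler_wpM2l.
  by lra.
have bw := bounded_meas_templates.
split.
- by move=> z /third [_ _] h; apply: le_trans h _; lra.
- move=> z Dz; have [hS _ _] := third z Dz; have := second z Dz.
  have : `|r * s z| <= r * K.
    by rewrite normrM gtr0_norm // ler_wpM2l // ltW.
  move=> h1 h2; have -> : noisy_or (scaled r wt) z =
      (noisy_or (scaled r wt) z - r * s z) + r * s z by ring.
  apply: le_trans (ler_normD _ _) _; lra.
- apply: L2norm_le.
    apply: bounded_measB; [exact: bounded_meas_noisy_or|].
    exact: bounded_meas_lincomb.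
  move=> z Dz; have := second z Dz => h.
  rewrite /= (_ : lincomb _ _ z = r * s z); first lra.
  by rewrite sE /lincomb mulr_sumr.
Qed.

Lemma weight_hull_sub_intercept_hull (w : 'I_J -> plane R -> R) :
  weight_hull w `<=` intercept_hull w.
Proof.
move=> _ [p hp <-]; exists 0 => //; exists p => //.
by apply/funext => z; rewrite /affcomb add0r.
Qed.

Hypothesis w_free : free_with_one wt.

(** Stated for any [S] between the two hulls. The lower bound comes from
    the sum-to-one constraint, the upper bound from a vertex of the hull. *)
Lemma dist_hull_asymp (S : R -> set (plane R -> R)) : (2 <= J)%N ->
  (forall r, weight_hull (scaled r wt) `<=` S r) ->
  (forall r, S r `<=` intercept_hull (scaled r wt)) ->
  asymp (fun r => L2dist (noisy_or (scaled r wt)) (S r) ^+ 2)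
        (fun r => r ^+ 2).
Proof.
move=> J2 hS Sh.
have bw := bounded_meas_templates.
have bw1 := bounded_meas_with_one bw.
have [K K0 HK] := noisy_or_expansion.
have [C C0 HC] := coef_le_L2norm bw1 (free_with_oneE w_free).
have J0 : (0 : R) < J%:R by rewrite ltr0n (ltn_trans _ J2).
pose j0 : 'I_J := Ordinal (ltnW J2).
have m0 : 0 < (2 * J%:R * C)^-1 by rewrite invr_gt0 !mulr_gt0.
pose m := (2 * J%:R * C)^-1.
pose p0 (j : 'I_J) : R := (j == j0)%:R.
have p0h r : weight_hull (scaled r wt) (scaled r wt j0).
  exists p0.
    split=> [j|]; first exact: ler0n.
    by rewrite (bigD1 j0) //= /p0 eqxx big1 ?addr0 // => j /negPf ->.
  apply/funext => z; rewrite /lincomb (bigD1 j0) //= {1}/p0 eqxx mul1r.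
  by rewrite big1 ?addr0 // => j /negPf jj; rewrite /p0 jj mul0r.
(* The first-order term is at distance at least [2 * m * r] from the hull; for
   [r <= m / K] the error [K * r ^+ 2] consumes at most half of it. *)
apply: (@asymp_sqr _ _ m (K + 1) (Num.min 1 (m / K))) => //.
- by lra.
- by rewrite lt_min ltr01 divr_gt0.
move=> r /andP[r0]; rewrite le_min => /andP[r1 rm].
have [_ f1 f2] := HK r (introT andP (conj r0 r1)).
have bf := bounded_meas_noisy_or r.
have bs : bounded_meas (lincomb (fun=> r) wt) by exact: bounded_meas_lincomb.
apply/andP; split; last first.
  have bsw : bounded_meas (scaled r wt j0) by exact: bounded_measZ.
  apply: (@le_trans _ _ (L2norm (noisy_or (scaled r wt) \- scaled r wt j0))).
    apply: ge_inf; first by exists 0 => _ [h _ <-]; exact: L2norm_ge0.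
    by exists (scaled r wt j0) => //; apply: hS.
  apply: L2norm_le; first exact: bounded_measB.
  move=> z Dz; apply: le_trans (ler_normB _ _) _; rewrite mulrDl mul1r.
  apply: lerD; first exact: f1.
  have /andP[w0 w1] := wt_01 j0 Dz.
  by rewrite /scaled ger0_norm ?ler_piMr ?mulr_ge0 // ltW.
apply: lb_le_inf.
  exists (L2norm (noisy_or (scaled r wt) \- scaled r wt j0)).
  by exists (scaled r wt j0) => //; apply: hS.
move=> _ [h /Sh [c _ [p [p_ge0 p1] <-]] <-].
set f := noisy_or _; rewrite affcomb_scaled; set h' := affcomb _ _ _.
have bh : bounded_meas h'.
  by rewrite /h' affcombE; exact: bounded_meas_lincomb.
pose D := L2norm (lincomb (fun=> r) wt \- h').
have DE : D = L2norm (affcomb (- c) (fun j => r * (1 - p j)) wt).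
  apply: eq_L2norm => z _; rewrite /h' /affcomb /lincomb /= opprD addrCA.
  by congr (_ + _); rewrite -sumrB; apply: eq_bigr => j _; ring.
have hD j : r * (1 - p j) <= C * D.
  have := HC (fun i => oapp (fun j => r * (1 - p j)) (- c) (unlift ord0 i))
             (lift ord0 j).
  by rewrite liftK /= -affcombE -DE; apply: le_trans; exact: ler_norm.
(* The weights [1 - p j] sum to [J - 1], which is at least [1]. *)
have rJ : r <= J%:R * C * D.
  apply: (@le_trans _ _ (\sum_(j < J) r * (1 - p j))).
    have J1 : 1 <= J%:R - 1 :> R by rewrite lerBrDr (ler_nat R 2).
    by rewrite -mulr_sumr sumrB p1 sumr_const card_ord ler_peMr // ltW.
  apply: le_trans (ler_sum _ (fun j _ => hD j)) _.
  by rewrite sumr_const card_ord -mulrA mulr_natl.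
have DT : D <= L2norm (f \- h') + K * r ^+ 2.
  have -> : D = L2norm (fun z => 1 * (f \- h') z +
                 -1 * (f \- lincomb (fun=> r) wt) z).
    by apply: eq_L2norm => z _ /=; ring.
  apply: le_trans (L2norm_comb_le _ _ _ _) _; try exact: bounded_measB.
  by rewrite normrN normr1 !mul1r lerD2l.
have mD : 2 * m * r <= D.
  rewrite /m (_ : 2 * _ * r = r / (J%:R * C)); last first.
    by field; rewrite !gt_eqF.
  by rewrite ler_pdivrMr ?mulr_gt0 // mulrC.
have Kr : K * r ^+ 2 <= m * r.
  rewrite expr2 mulrA; apply: ler_wpM2r; first exact: ltW.
  by rewrite mulrC -ler_pdivlMr.
lra.
Qed.

End NoisyOr.

(** * Projection of the noisy-or *)

Section NoisyOrProjection.
Context {R : realType} {J : nat} (wt : 'I_J -> plane R -> R).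
Hypothesis wt_meas : forall j, measurable_fun unit_square (wt j).
Hypothesis wt_01 : forall j z, unit_square z -> 0 <= wt j z <= 1.

(** Common to both spans: [g r] gives the coefficients over [u] of the
    first-order term, which are [r] on each agent and [0] on the intercept. The
    constant [K] comes before [r], so it depends on [u] and [wt] alone. *)
Lemma noisy_or_projection n (u : 'I_n -> plane R -> R) (g : R -> 'I_n -> R) :
  (forall i, bounded_meas (u i)) -> free_family u ->
  (forall r, lincomb (g r) u = lincomb (fun=> r) wt) ->
  exists2 K : R, 0 < K & forall r, 0 < r <= 1 ->
  let f := noisy_or (scaled r wt) in
  [/\ exists h, is_orth_proj f (linspan u) h,
      forall b, is_orth_proj f (linspan u) (lincomb b u) ->
        forall i, `|b i - g r i| <= K * r ^+ 2
    & ~ L2mem (pair_interaction wt) (linspan u) ->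
      exists2 t : R, `|t| <= K * r &
        L2dist f (linspan u) ^+ 2 =
        r ^+ 4 * L2dist (pair_interaction wt) (linspan u) ^+ 2 * (1 + t)].
Proof.
move=> bu fu gE.
have [M M0 HM] := noisy_or_expansion wt_meas wt_01.
have [C C0 HC] := coef_le_L2norm bu fu.
have be := bounded_meas_pair_interaction wt_meas wt_01.
pose e := pair_interaction wt; pose d := L2dist e (linspan u).
(* [T] has to be chosen before [d] is known to be nonzero; for [d = 0] the
   division makes it [0]. *)
pose T := (2 * M * d + M ^+ 2) / d ^+ 2.
have d0 : 0 <= d.
  have [h _] := L2dist_linspanE bu fu be.
  by rewrite /d => ->; exact: L2norm_ge0.
have T0 : 0 <= T.
  by rewrite /T divr_ge0 ?exprn_ge0 // addr_ge0 ?mulr_ge0 ?exprn_ge0 // ltW.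
have CM : 0 < C * M by rewrite mulr_gt0.
exists (C * M + T) => [|r r01 f]; first exact: ltr_wpDr.
have /andP[r0 r1] := r01.
have [third _ second] := HM r r01.
have bf : bounded_meas f by exact: bounded_meas_noisy_or.
split.
- exact: exists_orth_proj.
- move=> b pb i; have := orth_proj_coef_le bu (g r) i HC (ltW C0) bf pb.
  rewrite gE => h; apply: le_trans h _; rewrite mulrDl -mulrA.
  apply: ler_wpDr; first by rewrite mulr_ge0 // exprn_ge0 // ltW.
  by apply: ler_wpM2l => //; exact: ltW.
- move=> /(L2dist_linspan_gt0 bu fu be) dpos.
  have us : linspan u (lincomb (fun=> 1) wt) by exists (g 1).
  have := L2dist_second_order bu fu r0 bf be us third.
  move=> /(sqr_relative_error dpos r01 (ltW M0)) [t tT tE].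
  exists t => //; apply: le_trans tT _; rewrite -/T ler_wpM2r ?(ltW r0) //.
  by rewrite lerDr ltW.
Qed.

End NoisyOrProjection.

Theorem theorem1 (R : realType) (J : nat) (wt : 'I_J -> plane R -> R)
    (hJ : (2 <= J)%N)
    (wt_meas : forall j, measurable_fun unit_square (wt j))
    (wt_01 : forall j z, unit_square z -> 0 <= wt j z <= 1)
    (wt_sym : forall j x y, unit_square (x, y) -> wt j (x, y) = wt j (y, x))
    (w_free : forall rho : R, 0 < rho <= 1 -> free_with_one (scaled rho wt)) :
  let w := fun rho : R => scaled rho wt in
  let wstar := fun rho : R => noisy_or (w rho) in
  (asymp (fun rho => L2dist (wstar rho) (intercept_hull (w rho)) ^+ 2)
         (fun rho => rho ^+ 2) /\
   asymp (fun rho => L2dist (wstar rho) (weight_hull (w rho)) ^+ 2)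
         (fun rho => rho ^+ 2)) /\
  (exists rho0 : R, 0 < rho0 <= 1 /\
   exists K : R, forall rho : R, 0 < rho <= rho0 ->
    [/\ (exists h, is_orth_proj (wstar rho) (intercept_span (w rho)) h) /\
        (forall b0 b,
           is_orth_proj (wstar rho) (intercept_span (w rho))
             (affcomb b0 b (w rho)) ->
           forall j, `|b j - 1| <= K * rho /\ 0 < b j),
        (exists h, is_orth_proj (wstar rho) (linspan (w rho)) h) /\
        (forall b,
           is_orth_proj (wstar rho) (linspan (w rho)) (lincomb b (w rho)) ->
           forall j, `|b j - 1| <= K * rho /\ 0 < b j),
        L2dist (wstar rho) (intercept_cone (w rho)) =
          L2dist (wstar rho) (intercept_span (w rho)) /\
        L2dist (wstar rho) (weight_cone (w rho)) =
          L2dist (wstar rho) (linspan (w rho)),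
        ~ L2mem (pair_interaction wt) (intercept_span (w rho)) ->
        exists2 t : R, `|t| <= K * rho &
          L2dist (wstar rho) (intercept_span (w rho)) ^+ 2 =
            rho ^+ 4 *
            L2dist (pair_interaction wt) (intercept_span (w rho)) ^+ 2 * (1 + t)
      & ~ L2mem (pair_interaction wt) (linspan wt) ->
        exists2 t : R, `|t| <= K * rho &
          L2dist (wstar rho) (linspan (w rho)) ^+ 2 =
            rho ^+ 4 * L2dist (pair_interaction wt) (linspan wt) ^+ 2 * (1 + t)]).
Proof.
move=> w wstar.
have wt_free : free_with_one wt.
  have := @w_free 1 (introT andP (conj ltr01 (lexx 1))).
  by rewrite (_ : scaled 1 wt = wt) //; apply/funext => j; apply/funext => z;
    rewrite /scaled mul1r.
have bw := bounded_meas_templates wt_meas wt_01.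
have bw1 := bounded_meas_with_one bw.
have bf rho : bounded_meas (wstar rho) by exact: bounded_meas_noisy_or.
split.
  split.
    apply: (dist_hull_asymp wt_meas wt_01 wt_free hJ) => rho //.
    exact: weight_hull_sub_intercept_hull.
  apply: (dist_hull_asymp wt_meas wt_01 wt_free hJ) => rho //.
  exact: weight_hull_sub_intercept_hull.
pose g1 rho (i : 'I_J.+1) : R := oapp (fun=> rho) 0 (unlift ord0 i).
have g1E rho : lincomb (g1 rho) (with_one wt) = lincomb (fun=> rho) wt.
  by rewrite -affcombE; apply/funext => z; rewrite /affcomb add0r.
have [K1 K10 H1] := noisy_or_projection wt_meas wt_01 bw1
  (free_with_oneE wt_free) g1E.
have [K0 K00 H0] := noisy_or_projection wt_meas wt_01 bw
  (free_with_one_free wt_free) (fun rho => erefl (lincomb (fun=> rho) wt)).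
pose K := K1 + K0; have K_gt0 : 0 < K by rewrite addr_gt0.
(* This threshold keeps the weights within [1 / 2] of [1], hence positive. *)
exists (Num.min 1 (2 * K)^-1); split.
  by rewrite lt_min ltr01 invr_gt0 mulr_gt0 //= ge_min lexx.
exists K => rho /andP[r0]; rewrite le_min => /andP[r1].
rewrite -[(2 * K)^-1]mul1r ler_pdivlMr ?mulr_gt0 // => rK.
have r01 : 0 < rho <= 1 by rewrite r0.
have rn0 : rho != 0 by rewrite gt_eqF.
have [ex1 coef1 dist1] := H1 rho r01; have [ex0 coef0 dist0] := H0 rho r01.
have widen (L t : R) : L <= K -> `|t| <= L * rho -> `|t| <= K * rho.
  by move=> LK h; apply: le_trans h _; rewrite ler_wpM2r // ltW.
have K1K : K1 <= K by rewrite lerDl ltW.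
have K0K : K0 <= K by rewrite lerDr ltW.
have near1 (L c : R) : L <= K -> `|rho * c - rho| <= L * rho ^+ 2 ->
    `|c - 1| <= K * rho /\ 0 < c.
  move=> LK; rewrite -[X in _ - X]mulr1 -mulrBr normrM gtr0_norm //.
  rewrite expr2 mulrCA ler_pM2l // => /(widen _ _ LK) h; split=> //.
  by move: h; rewrite ler_norml => /andP[h _]; lra.
have spanE : linspan (w rho) = linspan wt by exact: linspan_scaled.
have ispanE : intercept_span (w rho) = linspan (with_one wt).
  by rewrite intercept_span_scaled // intercept_spanE.
have coef1' b0 b : is_orth_proj (wstar rho) (intercept_span (w rho))
    (affcomb b0 b (w rho)) -> forall j, `|b j - 1| <= K * rho /\ 0 < b j.
  rewrite ispanE affcomb_scaled affcombE => /coef1 h j.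
  apply: (near1 _ _ K1K); have := h (lift ord0 j).
  by rewrite /g1 liftK.
have coef0' b : is_orth_proj (wstar rho) (linspan (w rho))
    (lincomb b (w rho)) -> forall j, `|b j - 1| <= K * rho /\ 0 < b j.
  rewrite spanE lincomb_scaled => /coef0 h j.
  by apply: (near1 _ _ K0K); exact: h.
split.
- by split=> //; rewrite ispanE.
- by split=> //; rewrite spanE.
- split.
    have [h ph] := ex1; rewrite -ispanE in ph.
    have [[b0 _ [b _ hE]] _] := ph; rewrite -hE in ph.
    have ph' := ph; rewrite ispanE in ph'.
    rewrite ispanE !(L2dist_orth_proj bw1 (bf rho) ph') //.
    + by case: ph'.
    + by exists b0 => //; exists b => // j; have [_ /ltW] := coef1' _ _ ph j.
    + by rewrite -ispanE => _ [c _ [g _ <-]]; exists c => //; exists g.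
  have [h ph] := ex0; rewrite -spanE in ph.
  have [[b _ hE] _] := ph; rewrite -hE in ph.
  have ph' := ph; rewrite spanE in ph'.
  rewrite spanE !(L2dist_orth_proj bw (bf rho) ph') //.
  + by case: ph'.
  + by exists b => // j; have [_ /ltW] := coef0' _ ph j.
  + by rewrite -spanE => _ [g _ <-]; exists g.
- by rewrite ispanE => /dist1 [t /(widen _ _ K1K) ? ?]; exists t.
- by rewrite spanE => /dist0 [t /(widen _ _ K0K) ? ?]; exists t.
Qed.
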